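(* Let $p$ be a prime and $q=p^3$, and let $\vec r=(r_1,r_2,r_3)$ be integers with $0\le r_3\le r_2\le r_1<p-r_2-r_3$. Put $N=r_1+r_2+r_3$. Then the restriction to $\mathrm{GL}_2(\mathbb F_p)$ of the representation $V_{\vec r}$ of $\mathrm{GL}_2(\mathbb F_q)$ decomposes as follows, where $mW$ denotes the direct sum of $m$ copies of $W$ and empty direct sums are zero. (1) If $r_1\ge r_2+r_3$, then $$V_{\vec r}|_{\mathrm{GL}_2(\mathbb F_p)}\cong \bigoplus_{i=0}^{r_3}(i+1)V_{N-2i}(i)\ \oplus\bigoplus_{i=r_3+1}^{r_2}(r_3+1)V_{N-2i}(i)\ \oplus\bigoplus_{i=r_2+1}^{r_2+r_3}(r_3+r_2+1-i)V_{N-2i}(i).$$ (2) If $r_1<r_2+r_3$, then $$V_{\vec r}|_{\mathrm{GL}_2(\mathbb F_p)}\cong \bigoplus_{i=0}^{r_3}(i+1)V_{N-2i}(i)\ \oplus\bigoplus_{i=r_3+1}^{r_2}(r_3+1)V_{N-2i}(i)\ \oplus\bigoplus_{i=r_2+1}^{r_1}(r_3+r_2+1-i)V_{N-2i}(i)\ \oplus\bigoplus_{i=r_1+1}^{\lfloor N/2\rfloor}(N-2i+1)V_{N-2i}(i).$$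
   Context: All representations are over a fixed algebraic closure $\overline{\mathbb F}_p$ of $\mathbb F_p$. For $r\ge 0$, $\mathrm{Sym}^r(\overline{\mathbb F}_p^2)$ is the $(r+1)$-dimensional space of homogeneous polynomials of degree $r$ in two variables $x,y$ over $\overline{\mathbb F}_p$, with $\begin{pmatrix}a&b\\c&d\end{pmatrix}\cdot P(x,y)=P(ax+cy,bx+dy)$. As a representation of $\mathrm{GL}_2(\mathbb F_p)$, $V_r(k)=\mathrm{Sym}^r(\overline{\mathbb F}_p^2)\otimes\det^k$ and $V_r=V_r(0)$. For $q=p^n$ and $\vec r=(r_1,\dots,r_n)$, $V_{\vec r}$ is the representation of $\mathrm{GL}_2(\mathbb F_q)$ on $\bigotimes_{i=1}^n\mathrm{Sym}^{r_i}(\overline{\mathbb F}_p^2)$ in which $\begin{pmatrix}a&b\\c&d\end{pmatrix}$ acts on the $i$-th tensor factor through $\begin{pmatrix}a^{p^{i-1}}&b^{p^{i-1}}\\c^{p^{i-1}}&d^{p^{i-1}}\end{pmatrix}$. Its restriction to $\mathrm{GL}_2(\mathbb F_p)$ is the ordinary tensor product $V_{r_1}\otimes\cdots\otimes V_{r_n}$. *)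

(* Defs.v *)
From HB Require Import structures.
From mathcomp Require Export all_boot all_order all_fingroup all_algebra.
From mathcomp Require Export all_solvable all_field all_character.
From mathcomp Require Export mpoly.

Set Implicit Arguments.
Unset Strict Implicit.
Unset Printing Implicit Defensive.

Import GRing.Theory.
Local Open Scope ring_scope.

Section SymMatrix.

Variable K : fieldType.

(* (a b; c d) . P(x, y) = P(a x + c y, b x + d y), with x = 'X_0, y = 'X_1. *)
Definition sym_act (A : 'M[K]_2) (P : {mpoly K[2]}) : {mpoly K[2]} :=
  P \mPo [tuple \sum_(i < 2) A i j *: 'X_i | j < 2].

(* The exponent of the monomial x^(r - i) y^i, for 0 <= i <= r. *)
Definition sym_mnm r (i : 'I_r.+1) : 'X_{1..2} :=
  [multinom (if k == ord0 then (r - i)%N else i) | k < 2].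

(* The matrix of sym_act A on the homogeneous polynomials of degree r, in the *)
(* basis of monomials x^(r - j) y^j; the j-th column is the image of the j-th *)
(* basis vector.                                                              *)
Definition sym_mx r (A : 'M[K]_2) : 'M[K]_r.+1 :=
  \matrix_(i, j) (sym_act A 'X_[sym_mnm j])@_(sym_mnm i).

Lemma sym_act1 P : sym_act 1%:M P = P.
Proof.
rewrite /sym_act -[RHS]comp_mpoly_id; congr (_ \mPo _).
apply: eq_from_tnth => j; rewrite !tnth_mktuple (bigD1 j) //= mxE eqxx scale1r.
by rewrite big1 ?addr0 // => i /negPf ij; rewrite mxE ij scale0r.
Qed.

Lemma sym_actM A B P : sym_act (A *m B) P = sym_act A (sym_act B P).
Proof.
rewrite /sym_act !(comp_mpolyE P) linear_sum /=.
apply: eq_bigr => m _; rewrite linearZ /=; congr (_ *: _).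
rewrite rmorph_prod; apply: eq_bigr => j _ /=.
rewrite rmorphXn /= !tnth_mktuple; congr (_ ^+ _).
rewrite raddf_sum /=; under [RHS]eq_bigr => k _.
  rewrite comp_mpolyZ comp_mpolyXU -tnth_nth tnth_mktuple scaler_sumr; over.
rewrite exchange_big; apply: eq_bigr => i _ /=.
rewrite mxE scaler_suml; apply: eq_bigr => k _.
by rewrite scalerA mulrC.
Qed.

Lemma sym_act_sum A r (F : 'I_r -> {mpoly K[2]}) :
  sym_act A (\sum_i F i) = \sum_i sym_act A (F i).
Proof. exact: (raddf_sum (comp_mpoly _)). Qed.

Lemma mdeg_sym_mnm r (i : 'I_r.+1) : mdeg (sym_mnm i) = r.
Proof.
rewrite mdegE big_ord_recl big_ord1 !mnmE /= subnK //.
by rewrite -ltnS.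
Qed.

Lemma sym_mnm_inj r : injective (@sym_mnm r).
Proof.
move=> i j /mnmP /(_ (lift ord0 ord0)); rewrite !mnmE /= => ij.
exact: val_inj.
Qed.

Lemma sym_mnmP r (m : 'X_{1..2}) : mdeg m = r -> exists i, m = @sym_mnm r i.
Proof.
rewrite mdegE big_ord_recl big_ord1 => dm.
have lt_m : (m (lift ord0 ord0) < r.+1)%N by rewrite ltnS -dm leq_addl.
exists (Ordinal lt_m); apply/mnmP => k; rewrite mnmE /=.
have [->|] := eqVneq k; first by rewrite -dm addnK.
case: k => [[|[|k]] ltk] // _.
by congr (m _); apply: val_inj.
Qed.

Lemma sym_act_homog A r (P : {mpoly K[2]}) :
  P \is r.-homog -> sym_act A P \is r.-homog.
Proof.
move=> homP; rewrite /sym_act comp_mpolyEX big_seq /=.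
apply: rpred_sum => m Pm; apply: dhomogZ.
rewrite -(dhomog_mf homP Pm) /= comp_mpolyX mdegE.
have homE j k : tnth [tuple \sum_i A i j *: 'X_i | j < 2] j ^+ k \is k.-homog.
  rewrite -[X in X.-homog]mul1n; apply: dhomogMn; rewrite tnth_mktuple.
  by apply: rpred_sum => i _; apply: dhomogZ; rewrite dhomogX /= mdeg1.
by rewrite !big_ord_recl !big_ord0 mulr1 addn0; apply: dhomogM.
Qed.

Lemma sym_expand r (P : {mpoly K[2]}) : P \is r.-homog ->
  P = \sum_(i < r.+1) P@_(sym_mnm i) *: 'X_[sym_mnm i].
Proof.
move=> homP; apply/mpolyP => m; rewrite raddf_sum /=.
have [dm | dm] := eqVneq (mdeg m) r; last first.
  rewrite (dhomog_nemf_coeff homP dm) big1 // => i _.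
  rewrite mcoeffZ mcoeffX; case: eqP => [mE | _]; last by rewrite mulr0.
  by rewrite -mE mdeg_sym_mnm eqxx in dm.
have [i ->] := sym_mnmP dm; rewrite (bigD1 i) //= mcoeffZ mcoeffX eqxx mulr1.
rewrite big1 ?addr0 // => j ji.
by rewrite mcoeffZ mcoeffX (inj_eq (@sym_mnm_inj r)) (negPf ji) mulr0.
Qed.

Lemma sym_mx1 r : sym_mx r 1%:M = 1%:M.
Proof.
apply/matrixP => i j; rewrite !mxE sym_act1 mcoeffX.
by rewrite (inj_eq (@sym_mnm_inj r)) eq_sym.
Qed.

Lemma sym_mxM r A B : sym_mx r (A *m B) = sym_mx r A *m sym_mx r B.
Proof.
apply/matrixP => i j; rewrite !mxE sym_actM.
have homj : sym_act B 'X_[sym_mnm j] \is r.-homog.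
  by apply: sym_act_homog; rewrite dhomogX /= mdeg_sym_mnm.
rewrite {1}(sym_expand homj) sym_act_sum (raddf_sum (mcoeff _)) /=.
by apply: eq_bigr => k _; rewrite /sym_act comp_mpolyZ mcoeffZ mulrC !mxE.
Qed.

End SymMatrix.

Section Frobenius.

Variables (k : fieldType) (p : nat).

Definition frobX of p \in [pchar k] := fun (i : nat) (x : k) => x ^+ (p ^ i).

Hypothesis chp : p \in [pchar k].

Lemma frobX_is_zmod_morphism i : zmod_morphism (frobX chp i).
Proof.
move=> x y; rewrite /frobX; elim: i => [|i IHi]; first by rewrite !expr1.
by rewrite expnSr !exprM IHi -!(pFrobenius_autE chp) rmorphB.
Qed.

Lemma frobX_is_monoid_morphism i : monoid_morphism (frobX chp i).
Proof. by split=> [|x y]; rewrite /frobX ?expr1n ?exprMn. Qed.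

HB.instance Definition _ i :=
  GRing.isZmodMorphism.Build k k (frobX chp i) (frobX_is_zmod_morphism i).
HB.instance Definition _ i :=
  GRing.isMonoidMorphism.Build k k (frobX chp i) (frobX_is_monoid_morphism i).

End Frobenius.

(* Throughout, a representation G -> GL_n(K) is multiplicative, so it is a    *)
(* left module in columns; an isomorphism of two such is mx_rsim. The tensor  *)
(* product prod_repr and the sums dadd_grepr, muln_grepr are the library's.   *)
Section GL2Repr.

Variables (k : finFieldType) (K : fieldType) (iota : {rmorphism k -> K}).

Lemma sym_mx_repr r :
  mx_repr 'GL_2[k] (fun g : {'GL_2[k]} => sym_mx r (map_mx iota (GLval g))).
Proof.
split=> [|g h _ _]; first by rewrite /= map_mx1 sym_mx1.
by rewrite -sym_mxM -map_mxM.
Qed.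

Definition sym_repr r := MxRepresentation (sym_mx_repr r).

Lemma detX_mx_repr n : mx_repr 'GL_2[k]
  (fun g : {'GL_2[k]} => (\det (map_mx iota (GLval g)) ^+ n)%:M : 'M[K]_1).
Proof.
split=> [|g h _ _]; first by rewrite /= map_mx1 det1 expr1n.
by rewrite GL_MxE map_mxM det_mulmx exprMn scalar_mxM.
Qed.

Definition detX_repr n := MxRepresentation (detX_mx_repr n).

(* V_r(n) = Sym^r (x) det^n *)
Definition Vdet r n : representation K 'GL_2[k] :=
  Representation (prod_repr (sym_repr r) (detX_repr n)).

End GL2Repr.

Section TensorProduct.

Variables (K : fieldType) (gT : finGroupType) (G : {group gT}).

Lemma trivial_mx_repr : mx_repr G (fun=> 1%:M : 'M[K]_1).
Proof. by split=> // g h _ _; rewrite mulmx1. Qed.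

Definition grepr1 : representation K G :=
  Representation (MxRepresentation trivial_mx_repr).

Definition prod_grepr (V W : representation K G) : representation K G :=
  Representation (prod_repr V W).

End TensorProduct.

Arguments grepr1 {K gT G}.

(* The tensor factors are indexed from 0, so that the i-th one is twisted by  *)
(* x |-> x ^ (p ^ i).                                                         *)
Definition Vtensor (p : nat) (k : finFieldType) (chp : p \in [pchar k])
    (K : fieldType) (iota : {rmorphism k -> K}) (n : nat) (r : n.-tuple nat) :
    representation K 'GL_2[k] :=
  \big[@prod_grepr _ _ _/grepr1]_(i < n)
     Representation (sym_repr (iota \o frobX chp i) (tnth r i)).

Section Restriction.

Variables (k l : finFieldType) (j : {rmorphism k -> l}).

Lemma map_GL_subproof (g : {'GL_2[k]}) : map_mx j (GLval g) \is a GRing.unit.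
Proof. by have := GL_unitmx g; rewrite -(map_unitmx j). Qed.

Definition map_GL (g : {'GL_2[k]}) : {'GL_2[l]} :=
  FinRing.unit _ (map_GL_subproof g).

Lemma map_GLM : {in 'GL_2[k]%g &, {morph map_GL : g h / (g * h)%g}}.
Proof. by move=> g h _ _; apply: val_inj; apply: map_mxM. Qed.

Canonical map_GL_morphism := Morphism map_GLM.

Definition res_GL (K : fieldType) (V : representation K 'GL_2[l]) :
    representation K 'GL_2[k] :=
  Representation (morphim_repr
    (subg_repr V (subsetT (map_GL @* 'GL_2[k])%G)) (subxx _)).

End Restriction.

(* Main.v *)
Require Import Defs.
From mathcomp Require Import ring zify.

(* Multiplication Sym^a (x) Sym^b -> Sym^(a+b) is equivariant and its kernel  *)
(* contains the image of Sym^(a-1) (x) Sym^(b-1) (x) det under the injective  *)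
(* multiplication by x (x) y - y (x) x. If (a + b)! is invertible, as is the  *)
(* case for a + b < p, polarization splits it, so counting dimensions gives   *)
(*   Sym^a (x) Sym^b = Sym^(a+b) (+) (Sym^(a-1) (x) Sym^(b-1) (x) det).       *)
(* Iteration gives Clebsch-Gordan. Since Frobenius is trivial on F_p, two     *)
(* applications split the restriction into summands V_(N - 2m)(m), with m     *)
(* ranging over [i, i + min(r1, r2 + r3 - 2i)] for each i in [0, r3], and     *)
(* it remains to count how many of these intervals contain a given m.         *)

Set Implicit Arguments.
Unset Strict Implicit.
Unset Printing Implicit Defensive.

Import GRing.Theory.
Local Open Scope ring_scope.

(** The heart is [clebsch_gordan_step]. Side by side, [polar] and [omega] form a square equivariant
    matrix: [polar] is a section of multiplication ([mult_polar]), equivariant because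
    multiplication is equivariant for the transposed matrix ([polar_hom]); [omega] is injective and
    killed by multiplication ([omega_inj], [mult_omega]), and picks up one determinant
    ([omega_hom]). Hence the matrix is injective, so invertible. After [clebsch_gordan] is applied
    twice ([rsim_triple]), both sides of the theorem are direct sums over lists of exponents. By
    [rsim_big_perm] it is enough that each exponent m has the same multiplicity in both lists, and
    that multiplicity is a number of integers between two bounds ([count_triple_weights]). *)

(** * Entries of Kronecker products *)

(** Follows the recursion of [tprod] on rows, so that the entry formula below is a direct
    induction. *)
Fixpoint tidx m n : 'I_m -> 'I_n -> 'I_(m * n) :=
  if m is m'.+1 return 'I_m -> 'I_n -> 'I_(m * n) then
    fun i k => match split (i : 'I_(1 + m')) with
               | inl _ => lshift (m' * n) k
               | inr i' => rshift n (tidx i' k)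
               end
  else fun i _ => match notF (ltn_ord i) with end.

Section TensorEntries.

Variable K : fieldType.

Lemma trow_entry n1 (A : 'rV[K]_n1) m2 n2 (B : 'M_(m2, n2)) k j l :
  trow A B k (tidx j l) = A 0 j * B k l.
Proof.
elim: n1 A j => [|n1 IHn] A j; first by case: j.
rewrite /= mxE; case: (splitP (j : 'I_(1 + n1))) => j' jE.
  have -> : j = lshift n1 j' :> 'I_(1 + n1) by apply: val_inj.
  by rewrite (unsplitK (inl l)) !mxE [j']ord1.
have -> : j = rshift 1 j' :> 'I_(1 + n1) by apply: val_inj.
by rewrite (unsplitK (inr _)) IHn mxE.
Qed.

Lemma tprod_entry m1 n1 (A : 'M[K]_(m1, n1)) m2 n2 (B : 'M_(m2, n2)) i j k l :
  tprod A B (tidx i k) (tidx j l) = A i j * B k l.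
Proof.
elim: m1 A i => [|m1 IHm] A i; first by case: i.
rewrite /= mxE; case: (splitP (i : 'I_(1 + m1))) => i' iE.
  have -> : i = lshift m1 i' :> 'I_(1 + m1) by apply: val_inj.
  by rewrite (unsplitK (inl k)) trow_entry mxE [i']ord1.
have -> : i = rshift 1 i' :> 'I_(1 + m1) by apply: val_inj.
by rewrite (unsplitK (inr _)) IHm mxE.
Qed.

End TensorEntries.

(** Injective because the tensor product of two identity matrices is the identity: its entry at
    equal indices is 1, which forces both delta factors to be 1. *)
Lemma tidx_bij m n : bijective (fun x : 'I_m * 'I_n => tidx x.1 x.2).
Proof.
apply: inj_card_bij; last by rewrite card_prod !card_ord.
move=> [i k] [j l] /= eq_ik; apply/eqP.
have := tprod_entry (1%:M : 'M[rat]_m) (1%:M : 'M[rat]_n) i j k l.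
rewrite tprod1 !mxE eq_ik eqxx -natrM mulnb xpair_eqE.
by case: andP => // _ /eqP; rewrite oner_eq0.
Qed.

(** * Similarity of representations through index types; sums and products *)

Section Models.

Variables (K : fieldType) (gT : finGroupType) (G : {group gT}).
Implicit Types V W U : representation K G.

(* The matrices of V have entries rho after identifying I with the row        *)
(* indices. Direct sums and tensor products then live on I + J and I * J, so  *)
(* that associativity and the like are bijections of index types.             *)
Definition models V (I : finType) (rho : gT -> I -> I -> K) :=
  exists2 e : I -> 'I_(rdegree V), bijective e &
    {in G, forall g i j, V g (e i) (e j) = rho g i j}.

Lemma models_entries V : models V (fun g i j => V g i j).
Proof. by exists id => //; exists id. Qed.

Lemma models_reindex V (I J : finType) rho (sigma : gT -> J -> J -> K)
    (f : J -> I) :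
    models V rho -> bijective f ->
    {in G, forall g i j, rho g (f i) (f j) = sigma g i j} -> models V sigma.
Proof.
case=> e bij_e eE bij_f fE; exists (e \o f); first exact: bij_comp.
by move=> g Gg i j /=; rewrite eE // fE.
Qed.

Lemma models_dadd V W (I J : finType) (rho : gT -> I -> I -> K)
    (sigma : gT -> J -> J -> K) :
    models V rho -> models W sigma ->
  models (dadd_grepr V W) (fun g x y =>
    match x, y with
    | inl i, inl j => rho g i j
    | inr i, inr j => sigma g i j
    | _, _ => 0
    end).
Proof.
move=> [e [e' eK e'K] eE] [f [f' fK f'K] fE].
pose h (x : I + J) := unsplit
  (match x with inl i => inl (e i) | inr j => inr (f j) end).
exists h.
  exists (fun z => match split z with
                   | inl x => inl (e' x) | inr y => inr (f' y) end) => [x|z].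
    by rewrite unsplitK; case: x => x /=; rewrite ?eK ?fK.
  rewrite /h -[RHS]splitK; congr unsplit.
  by case: (split z) => x; rewrite ?e'K ?f'K.
move=> g Gg [] i [] j; rewrite /h /= ?block_mxEul ?block_mxEur ?block_mxEdl.
all: by rewrite ?block_mxEdr ?mxE ?eE ?fE.
Qed.

Lemma models_prod V W (I J : finType) (rho : gT -> I -> I -> K)
    (sigma : gT -> J -> J -> K) :
    models V rho -> models W sigma ->
  models (prod_grepr V W) (fun g x y => rho g x.1 y.1 * sigma g x.2 y.2).
Proof.
move=> [e [e' eK e'K] eE] [f [f' fK f'K] fE].
exists (fun x => tidx (e x.1) (f x.2)).
  apply: bij_comp (tidx_bij _ _) (_ : bijective (fun x : I * J => (e x.1, f x.2))).
  exists (fun z => (e' z.1, f' z.2)) => [[i j]|[i j]] /=; rewrite ?eK ?fK //.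
  by rewrite e'K f'K.
by move=> g Gg [i k] [j l] /=; rewrite tprod_entry eE ?fE.
Qed.

(** In columns, [B] is an equivariant map from [W] to [V]. It is injective by the last hypothesis,
    hence invertible because the dimensions agree. *)
Lemma models_rsim V W (I J : finType) (rho : gT -> I -> I -> K)
    (sigma : gT -> J -> J -> K) (B : I -> J -> K) :
    models V rho -> models W sigma -> #|I| = #|J| ->
    {in G, forall g i j,
       \sum_k rho g i k * B k j = \sum_k B i k * sigma g k j} ->
    (forall v : J -> K, (forall i, \sum_j B i j * v j = 0) -> v =1 fun=> 0) ->
  mx_rsim V W.
Proof.
move=> [e [e' eK e'K] eE] [f [f' fK f'K] fE] cardIJ BE Binj.
have degE : rdegree V = rdegree W.
  rewrite -(card_ord (rdegree V)) -(card_ord (rdegree W)).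
  by rewrite -(bij_eq_card (Bijective eK e'K)) cardIJ
             (bij_eq_card (Bijective fK f'K)).
pose M := \matrix_(x, y) B (e' x) (f' y).
exists M => //.
  (* Injectivity on columns is freeness of the rows of the transpose, which has the same rank. *)
  suff : row_free M^T by rewrite /row_free mxrank_tr => /eqP ->; rewrite degE.
  apply: inj_row_free => v vM0; apply/rowP => y; rewrite mxE.
  rewrite -(f'K y); apply: (Binj (fun j => v 0 (f j))) => i.
  have /rowP/(_ (e i)) := vM0; rewrite !mxE (reindex f) /=; last first.
    exact: onW_bij (Bijective fK f'K).
  by under eq_bigr => j _ do rewrite !mxE eK fK mulrC.
move=> g Gg; apply/matrixP => x y; rewrite !mxE -(e'K x) -(f'K y).
rewrite (reindex e) /=; last exact: onW_bij (Bijective eK e'K).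
rewrite [RHS](reindex f) /=; last exact: onW_bij (Bijective fK f'K).
under eq_bigr => k _ do rewrite !mxE !(eK, fK) eE //.
under [RHS]eq_bigr => k _ do rewrite !mxE !(eK, fK) fE //.
exact: BE.
Qed.

Lemma models_eq_rsim V W (I : finType) (rho : gT -> I -> I -> K) :
  models V rho -> models W rho -> mx_rsim V W.
Proof.
move=> mV mW.
have sum_delta (F : I -> K) i : \sum_k (i == k)%:R * F k = F i.
  rewrite (bigD1 i) //= eqxx mul1r big1 ?addr0 // => k ki.
  by rewrite eq_sym (negPf ki) mul0r.
apply: (models_rsim (B := fun i j => (i == j)%:R) mV mW) => // [g Gg i j|v v0 i].
  by under eq_bigr => k _ do rewrite mulrC eq_sym; rewrite !sum_delta.
by rewrite -[LHS](sum_delta v).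
Qed.

Lemma rsim_dadd V V' W W' : mx_rsim V V' -> mx_rsim W W' ->
  mx_rsim (dadd_grepr V W) (dadd_grepr V' W').
Proof.
case=> B nV /row_freeP[B' BK] BE [C nW /row_freeP[C' CK] CE].
exists (block_mx B 0 0 C) => [||g Gg]; first by rewrite /= nV nW.
  apply/row_freeP; exists (block_mx B' 0 0 C').
  by rewrite mulmx_block !(mulmx0, mul0mx, addr0, add0r) BK CK -scalar_mx_block.
by rewrite !mulmx_block !(mulmx0, mul0mx, addr0, add0r) BE ?CE.
Qed.

Lemma rsim_prod V V' W W' : mx_rsim V V' -> mx_rsim W W' ->
  mx_rsim (prod_grepr V W) (prod_grepr V' W').
Proof.
case=> B nV /row_freeP[B' BK] BE [C nW /row_freeP[C' CK] CE].
exists (tprod B C) => [||g Gg]; first by rewrite /= nV nW.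
  by apply/row_freeP; exists (tprod B' C'); rewrite -tprodE BK CK tprod1.
by rewrite -!tprodE BE ?CE.
Qed.

Lemma rsim_daddC V W : mx_rsim (dadd_grepr V W) (dadd_grepr W V).
Proof.
have mV := models_entries V; have mW := models_entries W.
apply: models_eq_rsim (models_dadd mV mW) _.
apply: (models_reindex (f := fun x => match x with
  inl i => inr i | inr j => inl j end) (models_dadd mW mV)) => [|g _ [] i [] j //].
by exists (fun x => match x with inl i => inr i | inr j => inl j end); case.
Qed.

Lemma rsim_daddA V W U :
  mx_rsim (dadd_grepr V (dadd_grepr W U)) (dadd_grepr (dadd_grepr V W) U).
Proof.
have [mV mW] := (models_entries V, models_entries W).
have mU := models_entries U.
apply: models_eq_rsim (models_dadd mV (models_dadd mW mU)) _.
apply: (models_reindex (f := fun x => match x with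
  inl i => inl (inl i) | inr (inl j) => inl (inr j) | inr (inr k) => inr k end)
    (models_dadd (models_dadd mV mW) mU)); last by move=> g _ [i|[i|i]] [j|[j|j]].
exists (fun x => match x with inl (inl i) => inl i | inl (inr j) => inr (inl j)
  | inr k => inr (inr k) end) => [[i|[j|k]]|[[i|j]|k]] //.
Qed.

Lemma rsim_dadd0 V : mx_rsim (dadd_grepr grepr0 V) V.
Proof.
have mV := models_entries V.
apply: models_eq_rsim (models_dadd (models_entries grepr0) mV) _.
apply: (models_reindex (f := fun x : 'I_0 + _ => match x with
  inl i => match notF (ltn_ord i) with end | inr j => j end) mV).
  by exists inr => [[[]|]|].
by move=> g _ [[]|i] // [[]|j].
Qed.

Lemma rsim_prod_daddr V W U : mx_rsim (prod_grepr V (dadd_grepr W U))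
  (dadd_grepr (prod_grepr V W) (prod_grepr V U)).
Proof.
have [mV mW] := (models_entries V, models_entries W).
have mU := models_entries U.
apply: models_eq_rsim (models_prod mV (models_dadd mW mU)) _.
apply: (models_reindex (f := fun x => match x with
    | (i, inl j) => inl (i, j) | (i, inr j) => inr (i, j) end)
    (models_dadd (models_prod mV mW) (models_prod mV mU))); last first.
  by move=> g _ [i [j|j]] [k [l|l]] //=; rewrite mulr0.
exists (fun x => match x with inl (i, j) => (i, inl j)
  | inr (i, j) => (i, inr j) end) => [[i [j|j]]|[[i j]|[i j]]] //.
Qed.

Lemma rsim_prod0 V : mx_rsim (prod_grepr V grepr0) grepr0.
Proof.
exists 0 => [||g Gg]; first exact: muln0; last by rewrite mulmx0 mul0mx.
by rewrite /row_free mxrank0 /= muln0.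
Qed.

(** * Direct sums over lists *)

Section BigSums.

Variables (I : Type) (V : I -> representation K G).
Local Notation dsum s := (\big[dadd_grepr/grepr0]_(i <- s) V i).

Lemma rsim_big_seq1 i : mx_rsim (dsum [:: i]) (V i).
Proof.
rewrite big_cons big_nil; apply: mx_rsim_trans (rsim_daddC _ _) _.
exact: rsim_dadd0.
Qed.

Lemma rsim_big_cat s t : mx_rsim (dsum (s ++ t)) (dadd_grepr (dsum s) (dsum t)).
Proof.
elim: s => [|i s IHs] /=.
  by rewrite big_nil; apply/mx_rsim_sym/rsim_dadd0.
rewrite !big_cons; apply: mx_rsim_trans (rsim_daddA _ _ _).
exact: rsim_dadd (mx_rsim_refl _) IHs.
Qed.

Lemma rsim_big_flatten (ss : seq (seq I)) :
  mx_rsim (dsum (flatten ss)) (\big[dadd_grepr/grepr0]_(s <- ss) dsum s).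
Proof.
elim: ss => [|s ss IHss] /=; first by rewrite !big_nil; apply: mx_rsim_refl.
rewrite big_cons; apply: mx_rsim_trans (rsim_big_cat _ _) _.
exact: rsim_dadd (mx_rsim_refl _) IHss.
Qed.

End BigSums.

Lemma rsim_big_seq (I : eqType) (V W : I -> representation K G) s :
    {in s, forall i, mx_rsim (V i) (W i)} ->
  mx_rsim (\big[dadd_grepr/grepr0]_(i <- s) V i)
          (\big[dadd_grepr/grepr0]_(i <- s) W i).
Proof.
elim: s => [|i s IHs] VW; first by rewrite !big_nil; apply: mx_rsim_refl.
rewrite !big_cons; apply: rsim_dadd; first by apply: VW; rewrite mem_head.
by apply: IHs => j sj; apply: VW; rewrite inE sj orbT.
Qed.

(** This reduces the comparison of two decompositions to counting multiplicities in lists. *)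
Lemma rsim_big_perm (I : eqType) (V : I -> representation K G) s t :
    perm_eq s t ->
  mx_rsim (\big[dadd_grepr/grepr0]_(i <- s) V i)
          (\big[dadd_grepr/grepr0]_(i <- t) V i).
Proof.
elim: s t => [|i s IHs] t eq_st.
  by rewrite [t](perm_nilP _) 1?perm_sym // !big_nil; apply: mx_rsim_refl.
have t_i : i \in t by rewrite -(perm_mem eq_st) mem_head.
case/splitPr: t_i eq_st => t1 t2 /permPl eq_st.
have {}eq_st : perm_eq s (t1 ++ t2).
  by rewrite -(perm_cons i) eq_st perm_catC /= perm_cons perm_catC.
rewrite big_cons; apply: mx_rsim_trans (mx_rsim_sym (rsim_big_cat _ _ _)).
rewrite big_cons.
apply: mx_rsim_trans (rsim_dadd (mx_rsim_refl _) (IHs _ eq_st)) _.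
apply: mx_rsim_trans (rsim_dadd (mx_rsim_refl _) (rsim_big_cat _ _ _)) _.
apply: mx_rsim_trans (rsim_daddA _ _ _) _.
apply: mx_rsim_trans (rsim_dadd (rsim_daddC _ _) (mx_rsim_refl _)) _.
exact: mx_rsim_sym (rsim_daddA _ _ _).
Qed.

Lemma rsim_prod_big (I : Type) V (W : I -> representation K G) s :
  mx_rsim (prod_grepr V (\big[dadd_grepr/grepr0]_(i <- s) W i))
          (\big[dadd_grepr/grepr0]_(i <- s) prod_grepr V (W i)).
Proof.
elim: s => [|i s IHs]; first by rewrite !big_nil; apply: rsim_prod0.
rewrite !big_cons; apply: mx_rsim_trans (rsim_prod_daddr _ _ _) _.
exact: rsim_dadd (mx_rsim_refl _) IHs.
Qed.

Lemma muln_grepr_big (I : Type) (V : I -> representation K G) i n :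
  muln_grepr (V i) n = \big[dadd_grepr/grepr0]_(k <- nseq n i) V k.
Proof.
rewrite /muln_grepr; elim: n => [|n IHn]; first by rewrite big_ord0 big_nil.
by rewrite big_ord_recl IHn big_cons.
Qed.

End Models.

(** * Columns of symmetric powers as polynomials *)

Section SymColumns.

Variable K : fieldType.
Implicit Types A : 'M[K]_2.

(* A . x^m y^n at x = 1, y = 'X *)
Definition sym_col A m n : {poly K} :=
  ((A 0 0)%:P + A 1 0 *: 'X) ^+ m * ((A 0 1)%:P + A 1 1 *: 'X) ^+ n.

(** Dehomogenizing at x = 1 loses nothing in a fixed degree: x^(r-i) y^i becomes ['X^i], so
    coefficients can still be read off. *)
Lemma sym_mxE r A i j : sym_mx r A i j = (sym_col A (r - j) j)`_i.
Proof.
pose h (k : 'I_2) : {poly K} := if k == 0 then 1 else 'X.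
pose P := sym_act A 'X_[sym_mnm j].
have homP : P \is r.-homog.
  by apply: sym_act_homog; rewrite dhomogX /= mdeg_sym_mnm.
have -> : sym_col A (r - j) j = mmap (@polyC K) h P.
  rewrite /P /sym_act comp_mpolyX rmorph_prod /=.
  rewrite big_ord_recl big_ord1 !rmorphXn /= !tnth_mktuple !mnmE /=.
  rewrite !(big_ord_recl 1) !big_ord1 !mmapD !mmapZ !mmapX.
  rewrite !mmap1U /h /= !mulr1 !mul_polyC /sym_col.
  by congr ((_%:P + _ *: 'X) ^+ _ * (_%:P + _ *: 'X) ^+ _); congr (A _ _);
     apply: val_inj.
rewrite mxE -/P [in RHS](sym_expand homP).
rewrite (raddf_sum (mmap (@polyC K) h)) coef_sum.
rewrite (bigD1 i) //= big1 => [|k ki].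
  rewrite addr0 mmapZ mmapX /mmap1 big_ord_recl big_ord1 !mnmE /h /=.
  by rewrite expr1n mul1r coefCM coefXn eqxx mulr1.
rewrite mmapZ mmapX /mmap1 big_ord_recl big_ord1 !mnmE /h /=.
rewrite expr1n mul1r coefCM coefXn eq_sym.
by rewrite [_ == _](negPf ki : (val k == val i) = false) mulr0.
Qed.

Lemma size_sym_col A m n : (size (sym_col A m n) <= (m + n).+1)%N.
Proof.
have sz (x y : K) k : (size ((x%:P + y *: 'X) ^+ k)%R <= k.+1)%N.
  apply: leq_trans (size_poly_exp_leq _ _) _; rewrite ltnS.
  rewrite -[leqRHS]mul1n leq_mul2r -subn1 leq_subLR addn1.
  rewrite (leq_trans (size_polyD _ _)) ?orbT // geq_max.
  rewrite (leq_trans (size_polyC_leq1 _)) // (leq_trans (size_scale_leq _ _)) //.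
  by rewrite size_polyX.
apply: leq_trans (size_polyMleq _ _) _.
have := sz (A 0 0) (A 1 0) m; have := sz (A 0 1) (A 1 1) n; lia.
Qed.

Lemma sym_colM A m n m' n' :
  sym_col A m n * sym_col A m' n' = sym_col A (m + m') (n + n').
Proof. by rewrite /sym_col !exprD; ring. Qed.

Lemma sym_colS1 A m n i : (sym_col A m.+1 n)`_i =
  A 0 0 * (sym_col A m n)`_i + A 1 0 * (sym_col A m n * 'X)`_i.
Proof.
rewrite /sym_col exprS -mulrA mulrDl coefD coefCM -scalerAl coefZ.
by rewrite ['X * _]mulrC.
Qed.

Lemma sym_colS2 A m n i : (sym_col A m n.+1)`_i =
  A 0 1 * (sym_col A m n)`_i + A 1 1 * (sym_col A m n * 'X)`_i.
Proof.
rewrite /sym_col exprS mulrCA mulrDl coefD coefCM -scalerAl coefZ.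
by rewrite ['X * _]mulrC.
Qed.

(* Both sides are the coefficient of X^i Y^j in                               *)
(* (A00 + A10 X + A01 Y + A11 X Y)^r.                                         *)
Lemma sym_mx_tr r A i j :
  sym_mx r A i j * 'C(r, j)%:R = 'C(r, i)%:R * sym_mx r A^T j i.
Proof.
pose T A : {poly {poly K}} := ((A 0 0)%:P + A 1 0 *: 'X)%:P
  + ((A 0 1)%:P + A 1 1 *: 'X)%:P * 'X.
have coefT A' (k l : 'I_r.+1) :
    ((T A' ^+ r)`_l)`_k = sym_mx r A' k l * 'C(r, l)%:R.
  rewrite /T exprDn coef_sum (bigD1 l) //= big1 => [|s sl].
    rewrite addr0 coefMn exprMn -!rmorphXn /= mulrA -rmorphM /= coefCM coefXn.
    by rewrite eqxx mulr1 coefMn mulr_natr sym_mxE.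
  rewrite coefMn exprMn -!rmorphXn /= mulrA -rmorphM /= coefCM coefXn.
  by rewrite eq_sym [_ == _](negPf sl : (val s == val l) = false) mulr0 mul0rn.
(* Transposing A exchanges the two variables. *)
have TE : swapXY (T A^T) = T A.
  rewrite /T !rmorphD rmorphM /= swapXY_X !swapXY_polyC !rmorphD /=.
  rewrite !map_polyC /= !map_polyZ /= !map_polyX !mxE -!mul_polyC.
  rewrite /= !rmorphM /= swapXY_Y !swapXY_polyC !map_polyC /=; ring.
by rewrite -coefT mulrC -coefT -TE -rmorphXn coef_swapXY.
Qed.

End SymColumns.

Section CoefficientSums.

Variable K : fieldType.
Implicit Types (p q : {poly K}) (i k : nat).

Lemma sum_delta_coef p m i : (size p <= m)%N ->
  \sum_(k < m) (i == k :> nat)%:R * p`_k = p`_i.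
Proof.
move=> szp; have [lt_im | le_mi] := ltnP i m.
  rewrite (bigD1 (Ordinal lt_im)) //= eqxx mul1r big1 ?addr0 // => k.
  by rewrite -val_eqE /= eq_sym => /negPf->; rewrite mul0r.
rewrite nth_default ?(leq_trans szp) // big1 // => k _.
by rewrite gtn_eqF ?mul0r // (leq_trans (ltn_ord k)).
Qed.

Lemma sum_deltaS_coef p m i : (size p <= m)%N ->
  \sum_(k < m) (i == k.+1)%:R * p`_k = (p * 'X)`_i.
Proof.
move=> szp; rewrite coefMX; case: i => [|i] /=.
  by rewrite big1 // => k _; rewrite mul0r.
by under eq_bigr => k _ do rewrite eqSS; apply: sum_delta_coef.
Qed.

(** The sum runs over the whole rectangle, not an antidiagonal, because the rectangle is the index
    type of the tensor product. *)
Lemma coefM_rect p q m n k : (size p <= m)%N -> (size q <= n)%N ->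
  \sum_(ij : 'I_m * 'I_n) (k == ij.1 + ij.2)%N%:R * (p`_ij.1 * q`_ij.2)
    = (p * q)`_k.
Proof.
move=> szp szq; have pE (r : {poly K}) s : (size r <= s)%N ->
  r = \sum_(i < s) r`_i *: 'X^i.
- by move=> szr; rewrite -poly_def; apply/polyP => i; rewrite coef_poly;
     case: ltnP => // le_si; rewrite nth_default ?(leq_trans szr).
rewrite [in RHS](pE p m) // [in RHS](pE q n) //.
rewrite big_distrlr /= pair_bigA /= coef_sum; apply: eq_bigr => ij _.
by rewrite -scalerAl -scalerAr -exprD !coefZ coefXn mulrC mulrA.
Qed.

End CoefficientSums.

(** * Multiplication and polarization *)

Section ClebschGordanMatrix.

Variables (K : fieldType) (a b : nat).
Implicit Type A : 'M[K]_2.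

(* (k == i + j)%:R is the matrix of multiplication Sym^a (x) Sym^b ->         *)
(* Sym^(a+b) in the monomial bases.                                           *)
Lemma sym_mx_mult A (k : 'I_(a + b).+1) (i : 'I_a.+1) (j : 'I_b.+1)
    (l : 'I_(a + b).+1) :
    l = (i + j)%N :> nat ->
  \sum_(u : 'I_a.+1 * 'I_b.+1) (k == u.1 + u.2 :> nat)%N%:R *
     (sym_mx a A u.1 i * sym_mx b A u.2 j) = sym_mx (a + b) A k l.
Proof.
move=> lE; rewrite sym_mxE lE.
have -> : ((a + b) - (i + j) = (a - i) + (b - j))%N.
  by have := ltn_ord i; have := ltn_ord j; lia.
rewrite -sym_colM -(@coefM_rect _ _ _ a.+1 b.+1); first last.
- by rewrite (leq_trans (size_sym_col _ _ _)) // subnK // -ltnS.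
- by rewrite (leq_trans (size_sym_col _ _ _)) // subnK // -ltnS.
by apply: eq_bigr => u _; rewrite !sym_mxE.
Qed.

(** Compare coefficients in (1 + X)^a (1 + X)^b = (1 + X)^(a+b). This is the normalization of
    [polar]. *)
Lemma Vandermonde_pair (k : nat) :
  \sum_(u : 'I_a.+1 * 'I_b.+1) (k == u.1 + u.2)%N%:R *
     ('C(a, u.1)%:R * 'C(b, u.2)%:R) = 'C(a + b, k)%:R :> K.
Proof.
have coef1X n i : ((1 + 'X : {poly K}) ^+ n)`_i = 'C(n, i)%:R.
  rewrite exprDn; under eq_bigr => s _ do rewrite expr1n mul1r -scaler_nat.
  rewrite -(poly_def n.+1 (fun s => 'C(n, s)%:R)) coef_poly; case: ltnP => // lt_ni.
  by rewrite bin_small.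
have sz n : (size ((1 + 'X : {poly K}) ^+ n)%R <= n.+1)%N.
  by apply/leq_sizeP => i lt_ni; rewrite coef1X bin_small.
rewrite -coef1X exprD -(@coefM_rect _ _ _ a.+1 b.+1) //.
by apply: eq_bigr => u _; rewrite !coef1X.
Qed.

(* Polarization, normalized to be a section of multiplication: the transpose  *)
(* of multiplication, conjugated by the weights 'C(r, i) of sym_mx_tr.        *)
Definition polar (u : 'I_a.+1 * 'I_b.+1) (k : 'I_(a + b).+1) : K :=
  (k == u.1 + u.2 :> nat)%N%:R * ('C(a, u.1)%:R * 'C(b, u.2)%:R)
    / 'C(a + b, k)%:R.

Hypothesis fact_neq0 : (a + b)`!%:R != 0 :> K.

Lemma bin_neq0 k : (k <= a + b)%N -> 'C(a + b, k)%:R != 0 :> K.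
Proof.
move=> le_k; apply: contraNneq fact_neq0 => C0.
by rewrite -(bin_fact le_k) natrM C0 mul0r.
Qed.

(** Multiplication is equivariant for the transpose of A; [sym_mx_tr] turns this into equivariance
    of the weighted transpose of multiplication for A. *)
Lemma polar_hom A u k :
  \sum_v (sym_mx a A u.1 v.1 * sym_mx b A u.2 v.2) * polar v k
    = \sum_l polar u l * sym_mx (a + b) A l k.
Proof.
have lt_u : (u.1 + u.2 < (a + b).+1)%N.
  by have := ltn_ord u.1; have := ltn_ord u.2; lia.
pose s := Ordinal lt_u.
have Ck : 'C(a + b, k)%:R != 0 :> K by apply: bin_neq0; rewrite -ltnS.
have Cs : 'C(a + b, s)%:R != 0 :> K by apply: bin_neq0; rewrite -ltnS.
transitivity ('C(a, u.1)%:R * 'C(b, u.2)%:R / 'C(a + b, k)%:R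
              * sym_mx (a + b) A^T k s).
  rewrite -(@sym_mx_mult _ _ u.1 u.2) // mulr_sumr; apply: eq_bigr => v _.
  have Ea := sym_mx_tr A u.1 v.1; have Eb := sym_mx_tr A u.2 v.2.
  transitivity ((k == v.1 + v.2 :> nat)%N%:R / 'C(a + b, k)%:R *
    ((sym_mx a A u.1 v.1 * 'C(a, v.1)%:R) *
     (sym_mx b A u.2 v.2 * 'C(b, v.2)%:R))); first by rewrite /polar; ring.
  by rewrite Ea Eb; ring.
(* Row u of [polar] is supported at s = u.1 + u.2. *)
rewrite (bigD1 s) //= big1 ?addr0 => [|l ls].
  rewrite /polar eqxx mul1r.
  apply: (mulIf Ck); rewrite -[RHS]mulrA (sym_mx_tr A s k).
  by move: Ck Cs => /=; move=> Ck Cs; field; rewrite Ck Cs.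
by rewrite /polar [_ == _ :> nat](negPf ls : (val l == val s) = false) !mul0r.
Qed.

Lemma mult_polar (k l : 'I_(a + b).+1) :
  \sum_(u : 'I_a.+1 * 'I_b.+1) (k == u.1 + u.2 :> nat)%N%:R * polar u l = (k == l)%:R.
Proof.
have [<-|kl] := eqVneq k l; last first.
  rewrite big1 // => u _; rewrite /polar.
  case: eqP => [ku|]; last by rewrite mul0r.
  by rewrite -ku eq_sym [_ == _](negPf kl : (val k == val l) = false) !mul0r mulr0.
have Ck : 'C(a + b, k)%:R != 0 :> K by apply: bin_neq0; rewrite -ltnS.
rewrite -[RHS](divff Ck) -[X in X / _]Vandermonde_pair mulr_suml.
by apply: eq_bigr => u _; rewrite /polar; case: eqP; rewrite ?(mul1r, mul0r).
Qed.

End ClebschGordanMatrix.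

Lemma det2 (R : comNzRingType) (A : 'M[R]_2) :
  \det A = A 0 0 * A 1 1 - A 0 1 * A 1 0.
Proof.
rewrite (expand_det_row _ 0) big_ord_recl big_ord1 /cofactor !det_mx11 !mxE /=.
rewrite expr0 expr1 mul1r mulN1r mulrN.
by congr (_ * A _ _ - A _ _ * A _ _); apply: val_inj.
Qed.

(** * The kernel of multiplication *)

Section OmegaMatrix.

Variables (K : fieldType) (a b : nat).
Implicit Type A : 'M[K]_2.

(* Multiplication by x (x) y - y (x) x *)
Definition omega (u : 'I_a.+2 * 'I_b.+2) (w : 'I_a.+1 * 'I_b.+1) : K :=
  (u.1 == w.1 :> nat)%:R * (u.2 == w.2.+1 :> nat)%:R
  - (u.1 == w.1.+1 :> nat)%:R * (u.2 == w.2 :> nat)%:R.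

(** Column w of [omega] has two nonzero entries. [F] takes naturals, so that the shifted indices
    need no bound proofs. *)
Lemma sum_omegal (F : nat -> nat -> K) w :
  \sum_u F (val u.1) (val u.2) * omega u w
    = F (val w.1) w.2.+1 - F w.1.+1 (val w.2).
Proof.
pose u1 := (widen_ord (leqnSn _) w.1, lift ord0 w.2) : 'I_a.+2 * 'I_b.+2.
pose u2 := (lift ord0 w.1, widen_ord (leqnSn _) w.2) : 'I_a.+2 * 'I_b.+2.
under eq_bigr => u _ do rewrite mulrBr.
rewrite sumrB (bigD1 u1) //= big1 => [|u uu1].
  rewrite (bigD1 u2) //= big1 => [|u uu2].
    by rewrite /= /bump !eqxx !mulr1 !addr0.
  rewrite -natrM mulnb; case: andP => [[/eqP e1 /eqP e2]|]; last by rewrite mulr0.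
  case/eqP: uu2; case: u e1 e2 => i j /= e1 e2.
  by congr (_, _); apply: val_inj.
rewrite -natrM mulnb; case: andP => [[/eqP e1 /eqP e2]|]; last by rewrite mulr0.
case/eqP: uu1; case: u e1 e2 => i j /= e1 e2.
by congr (_, _); apply: val_inj.
Qed.

Lemma sum_omegar (p q : {poly K}) u :
    (size p <= a.+1)%N -> (size q <= b.+1)%N ->
  \sum_w omega u w * (p`_w.1 * q`_w.2)
    = p`_u.1 * (q * 'X)`_u.2 - (p * 'X)`_u.1 * q`_u.2.
Proof.
move=> szp szq; rewrite -(sum_delta_coef _ szp) -(sum_deltaS_coef _ szp).
rewrite -(sum_delta_coef _ szq) -(sum_deltaS_coef _ szq).
rewrite !big_distrlr !pair_bigA /= -sumrB; apply: eq_bigr => w _.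
by rewrite /omega; ring.
Qed.

(** A sends x (x) y - y (x) x to its multiple by det A. The exponents are split off by [sym_colS1]
    and [sym_colS2], and the cross terms cancel. *)
Lemma omega_hom A u w :
  \sum_v (sym_mx a.+1 A u.1 v.1 * sym_mx b.+1 A u.2 v.2) * omega v w
    = \sum_v omega u v * (sym_mx a A v.1 w.1 * sym_mx b A v.2 w.2 * \det A).
Proof.
have [lt1 lt2] := (ltn_ord w.1, ltn_ord w.2).
pose F i j := (sym_col A (a.+1 - i) i)`_u.1 * (sym_col A (b.+1 - j) j)`_u.2.
under eq_bigr => v _ do rewrite !sym_mxE.
under [RHS]eq_bigr => v _ do rewrite !sym_mxE mulrA.
rewrite (sum_omegal F) -mulr_suml sum_omegar; first last.
- by rewrite (leq_trans (size_sym_col _ _ _)) // subnK // -ltnS.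
- by rewrite (leq_trans (size_sym_col _ _ _)) // subnK // -ltnS.
rewrite /F !subSS !subSn // !sym_colS1 !sym_colS2 det2; ring.
Qed.

Lemma mult_omega (k : nat) w :
  \sum_(u : 'I_a.+2 * 'I_b.+2) (k == u.1 + u.2)%N%:R * omega u w = 0.
Proof.
rewrite (sum_omegal (fun i j => (k == i + j)%N%:R)) addSnnS subrr //.
Qed.

(** The matrix is triangular: row (i, j+1) involves only v(i, j) and v(i-1, j+1), and the latter
    vanishes by induction on i or is absent. *)
Lemma omega_inj (v : 'I_a.+1 * 'I_b.+1 -> K) :
  (forall u, \sum_w omega u w * v w = 0) -> v =1 fun=> 0.
Proof.
move=> v0 w; have [n wn] := ubnP (val w.1); elim: n => // n IHn in w wn *.
have := v0 (widen_ord (leqnSn _) w.1, lift ord0 w.2).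
rewrite (bigD1 w) //= big1 => [|w' w'w].
  by rewrite /omega /= /bump !eqxx (ltn_eqF (ltnSn _)) mul0r subr0 !mul1r addr0.
rewrite /omega /= eqSS; have -> : (val w.1 == w'.1)%:R * (val w.2 == w'.2)%:R = 0 :> K.
  rewrite -natrM mulnb; case: andP => // [[/eqP e1 /eqP e2]]; case/eqP: w'w.
  by case: w w' e1 e2 {wn} => i j [i' j'] /= e1 e2; congr (_, _); apply: val_inj.
case: eqP => [e1|_]; last by rewrite mul0r subr0 mul0r.
by rewrite IHn ?mulr0 // -ltnS -e1.
Qed.

End OmegaMatrix.

(** * Clebsch-Gordan decomposition *)

Section ClebschGordan.

Variables (k : finFieldType) (K : fieldType) (iota : {rmorphism k -> K}).

Local Notation Sym r := (Representation (sym_repr iota r)).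
Local Notation V := (Vdet iota).

Lemma models_Vdet r t : models (V r t) (fun g (i j : 'I_r.+1) =>
  sym_mx r (map_mx iota (GLval g)) i j * \det (map_mx iota (GLval g)) ^+ t).
Proof.
have mS := models_entries (Sym r).
have mD := models_entries (Representation (detX_repr iota t)).
apply: (models_reindex (f := fun i => (i, ord0)) (models_prod mS mD)).
  by exists (fun x => x.1) => [|[i j]] //=; rewrite [j]ord1.
by move=> g Gg i j /=; rewrite [X in _ * X]mxE mulr1n.
Qed.

Lemma models_Sym_Vdet a b t : models (prod_grepr (Sym a) (V b t))
  (fun g (u v : 'I_a.+1 * 'I_b.+1) =>
     sym_mx a (map_mx iota (GLval g)) u.1 v.1 *
     sym_mx b (map_mx iota (GLval g)) u.2 v.2 *
     \det (map_mx iota (GLval g)) ^+ t).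
Proof.
have mS := models_entries (Sym a).
apply: (models_reindex (f := id) (models_prod mS (models_Vdet b t))).
  by exists id.
by move=> g Gg u v; rewrite mulrA.
Qed.

(** Dimensions match since (a+2)(b+2) = (a+b+3) + (a+1)(b+1), so injectivity of [B] suffices. *)
Lemma clebsch_gordan_step a b t : (a.+1 + b.+1)`!%:R != 0 :> K ->
  mx_rsim (prod_grepr (Sym a.+1) (V b.+1 t))
    (dadd_grepr (V (a.+1 + b.+1) t) (prod_grepr (Sym a) (V b t.+1))).
Proof.
move=> fact_neq0.
pose B (u : 'I_a.+2 * 'I_b.+2) (x : 'I_(a.+1 + b.+1).+1 + 'I_a.+1 * 'I_b.+1) :=
  match x with inl l => polar K u l | inr w => omega K u w end.
apply: (models_rsim (B := B) (models_Sym_Vdet _ _ _)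
  (models_dadd (models_Vdet _ _) (models_Sym_Vdet _ _ _))).
- by rewrite card_sum !card_prod !card_ord; lia.
- move=> g Gg u x; rewrite big_sumType /=; set A := map_mx _ _.
  case: x => [l | w] /=.
    rewrite [X in _ + X]big1 ?addr0 => [|w _]; last by rewrite mulr0.
    under [RHS]eq_bigr => s _ do rewrite mulrA.
    rewrite -mulr_suml -polar_hom // mulr_suml.
    by apply: eq_bigr => v _; rewrite mulrAC.
  rewrite [X in X + _]big1 ?add0r => [|s _]; last by rewrite mulr0.
  under [RHS]eq_bigr => v _ do rewrite exprS (mulrA _ (\det A)) mulrA.
  rewrite -mulr_suml -omega_hom mulr_suml.
  by apply: eq_bigr => v _; rewrite mulrAC.
move=> v vK0; have v0 u : \sum_s polar K u s * v (inl s) +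
    \sum_w omega K u w * v (inr w) = 0.
  by have := vK0 u; rewrite big_sumType.
have vl l : v (inl l) = 0.
  (* Applying multiplication kills the [omega] part and returns the coordinates of the [polar]
     part. *)
  have : \sum_(u : 'I_a.+2 * 'I_b.+2) (l == u.1 + u.2 :> nat)%N%:R *
    (\sum_s polar K u s * v (inl s) + \sum_w omega K u w * v (inr w)) = 0.
    by rewrite big1 // => u _; rewrite v0 mulr0.
  under eq_bigr => u _ do rewrite mulrDr !mulr_sumr.
  rewrite big_split /= exchange_big [X in _ + X]exchange_big /=.
  under eq_bigr => s _.
    under eq_bigr => u _ do rewrite mulrA.
    rewrite -mulr_suml mult_polar //; over.
  rewrite [X in _ + X]big1 => [|w _]; last first.
    by under eq_bigr => u _ do rewrite mulrA; rewrite -mulr_suml mult_omega mul0r.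
  rewrite addr0 (bigD1 l) //= big1 => [|s sl]; first by rewrite eqxx mul1r addr0.
  by rewrite eq_sym (negPf sl) mul0r.
case=> [l|w]; first exact: vl.
apply: (omega_inj (v := fun w => v (inr w))) => u.
by rewrite -[RHS](v0 u) [X in _ = X + _]big1 ?add0r // => s _; rewrite vl mulr0.
Qed.

Lemma rsim_Sym0_Vdet b t : mx_rsim (prod_grepr (Sym 0) (V b t)) (V b t).
Proof.
apply: models_eq_rsim (models_Vdet b t).
apply: (models_reindex (f := fun j => (ord0, j)) (models_Sym_Vdet 0 b t)).
  by exists (fun x => x.2) => [|[i j]] //=; rewrite [i]ord1.
by move=> g _ i j /=; rewrite sym_mxE /sym_col !expr0 mulr1 coef1 mul1r.
Qed.

Lemma rsim_Sym_Vdet0 a t : mx_rsim (prod_grepr (Sym a) (V 0 t)) (V a t).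
Proof.
apply: models_eq_rsim (models_Vdet a t).
apply: (models_reindex (f := fun i => (i, ord0)) (models_Sym_Vdet a 0 t)).
  by exists (fun x => x.1) => [|[i j]] //=; rewrite [j]ord1.
move=> g _ i j /=; congr (_ * _).
by rewrite [X in _ * X]sym_mxE /sym_col !expr0 mulr1 coef1 mulr1.
Qed.

(** [N] = a + b + 2t is unchanged when (a, b, t) becomes (a-1, b-1, t+1), so one [N] labels all
    summands. *)
Lemma clebsch_gordan a b t N :
    (a + b)`!%:R != 0 :> K -> (a + b + 2 * t)%N = N ->
  mx_rsim (prod_grepr (Sym a) (V b t))
    (\big[dadd_grepr/grepr0]_(m <- seq.iota t (minn a b).+1) V (N - 2 * m) m).
Proof.
move=> + <-; elim: a b t => [|a IHa] b t fact_neq0.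
  rewrite min0n; apply: mx_rsim_trans (mx_rsim_sym (rsim_big_seq1 _ _)).
  rewrite addnK; exact: rsim_Sym0_Vdet.
case: b fact_neq0 => [|b] fact_neq0.
  rewrite minn0; apply: mx_rsim_trans (mx_rsim_sym (rsim_big_seq1 _ _)).
  rewrite addnK addn0; exact: rsim_Sym_Vdet0.
rewrite minnSS big_cons addnK.
apply: mx_rsim_trans (clebsch_gordan_step _ fact_neq0) _.
apply: rsim_dadd (mx_rsim_refl _) _.
have -> : (a.+1 + b.+1 + 2 * t = a + b + 2 * t.+1)%N by lia.
apply: IHa; apply: contraNneq fact_neq0.
by rewrite addSn addnS !factS !natrM => ->; rewrite !mulr0.
Qed.

End ClebschGordan.

Lemma natr_fact_neq0 (K : fieldType) n N :
  (n <= N)%N -> N`!%:R != 0 :> K -> n`!%:R != 0 :> K.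
Proof.
move=> le_nN; apply: contraNneq => n0.
by rewrite -(bin_fact le_nN) !natrM n0 mul0r mulr0.
Qed.

Lemma natr_fact_pchar_neq0 (K : fieldType) p n :
  p \in [pchar K] -> (n < p)%N -> n`!%:R != 0 :> K.
Proof.
move=> charK; elim: n => [|n IHn] lt_np; first by rewrite oner_eq0.
rewrite factS natrM mulf_neq0 ?IHn ?(ltnW lt_np) //.
by rewrite -(dvdn_pcharf charK) gtnNdvd.
Qed.

(** * Threefold tensor products *)

Section TripleProduct.

Variables (k : finFieldType) (K : fieldType) (iota : {rmorphism k -> K}).

Local Notation Sym r := (Representation (sym_repr iota r)).
Local Notation V := (Vdet iota).

(* The exponents m of the summands V_(N - 2m)(m), with multiplicity. *)
Definition triple_weights r1 r2 r3 :=
  flatten [seq seq.iota i (minn r1 (r2 + r3 - 2 * i)).+1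
          | i <- seq.iota 0 (minn r2 r3).+1].

(** The second use of [clebsch_gordan], on Sym^r1 (x) V_(r2+r3-2i)(i), has again total r1 +
    (r2+r3-2i) + 2i = N. *)
Lemma rsim_triple r1 r2 r3 (N := (r1 + r2 + r3)%N) : N`!%:R != 0 :> K ->
  mx_rsim (prod_grepr (Sym r1) (prod_grepr (Sym r2) (V r3 0)))
    (\big[dadd_grepr/grepr0]_(m <- triple_weights r1 r2 r3) V (N - 2 * m) m).
Proof.
move=> N0; have fact0 n : (n <= N)%N -> n`!%:R != 0 :> K.
  by move=> /natr_fact_neq0; apply.
have le23 : (r2 + r3 <= N)%N by rewrite /N -addnA leq_addl.
have sim23 := clebsch_gordan iota (fact0 _ le23)
  (addn0 _ : (r2 + r3 + 2 * 0 = r2 + r3)%N).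
apply: mx_rsim_trans (rsim_prod (mx_rsim_refl (Sym r1)) sim23) _.
apply: mx_rsim_trans (rsim_prod_big _ _ _) _.
apply: mx_rsim_trans (mx_rsim_sym (rsim_big_flatten _ _)); rewrite big_map.
apply: rsim_big_seq => i; rewrite mem_iota add0n => /andP[_ lti].
by apply: clebsch_gordan; [apply: fact0|]; rewrite /N; lia.
Qed.

End TripleProduct.

(** * Counting multiplicities *)

Definition rep_weights lo hi (c : nat -> nat) :=
  flatten [seq nseq (c i) i | i <- index_iota lo hi].

Lemma rsim_big_muln (K : fieldType) (gT : finGroupType) (G : {group gT})
    (W : nat -> representation K G) c lo hi :
  mx_rsim (\big[dadd_grepr/grepr0]_(i <- rep_weights lo hi c) W i)
          (\big[dadd_grepr/grepr0]_(lo <= i < hi) muln_grepr (W i) (c i)).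
Proof.
have -> : \big[dadd_grepr/grepr0]_(lo <= i < hi) muln_grepr (W i) (c i) =
    \big[dadd_grepr/grepr0]_(s <- [seq nseq (c i) i | i <- index_iota lo hi])
      \big[dadd_grepr/grepr0]_(i <- s) W i.
  by rewrite big_map; apply: eq_bigr => i _; apply: muln_grepr_big.
exact: rsim_big_flatten.
Qed.

Lemma perm_count_mem (T : eqType) (s t : seq T) :
  (forall x, count_mem x s = count_mem x t) -> perm_eq s t.
Proof. by move=> st; apply/allP => x _; apply/eqP/st. Qed.

Lemma count_rep_weights lo hi c m :
  count_mem m (rep_weights lo hi c) = if (lo <= m < hi)%N then c m else 0%N.
Proof.
rewrite count_flatten sumnE !big_map -(big_nat1_eq addn) [RHS]big_mkcond /=.
by apply: eq_bigr => i _; rewrite count_nseq /=; case: eqP; rewrite ?mul1n.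
Qed.

Lemma sum_nat_interval n a b :
  (\sum_(0 <= i < n) (a <= i < b) = minn n b - a)%N.
Proof.
elim: n => [|n IHn]; first by rewrite big_geq // min0n.
by rewrite big_nat_recr //= IHn; lia.
Qed.

(** The interval of i contains m exactly when m - r1 <= i, i <= m and i <= r2 + r3 - m; the count is
    of such i up to r3. *)
Lemma count_triple_weights r1 r2 r3 m : (r3 <= r2)%N ->
  count_mem m (triple_weights r1 r2 r3)
    = (minn r3.+1 (minn m.+1 ((r2 + r3).+1 - m)) - (m - r1))%N.
Proof.
move=> le32; rewrite count_flatten sumnE !big_map (minn_idPr le32).
rewrite -[seq.iota 0 _]/(index_iota 0 r3.+1) -sum_nat_interval.
rewrite !big_nat; apply: eq_bigr => i /andP[_ lt_i].
by rewrite count_uniq_mem ?iota_uniq // mem_iota; congr nat_of_bool; lia.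
Qed.

(** The minimum is m+1, r3+1 and r2+r3+1-m on the successive ranges, and m - r1 truncates to 0
    wherever it is positive. *)
Lemma perm_triple_weights1 r1 r2 r3 : (r3 <= r2 <= r1)%N -> (r2 + r3 <= r1)%N ->
  perm_eq (triple_weights r1 r2 r3)
    (rep_weights 0 r3.+1 (fun i => i + 1)%N ++
     rep_weights r3.+1 r2.+1 (fun=> r3 + 1)%N ++
     rep_weights r2.+1 (r2 + r3).+1 (fun i => r3 + r2 + 1 - i)%N).
Proof.
move=> /andP[le32 le21] le_r1; apply: perm_count_mem => m.
rewrite count_triple_weights // !(count_rep_weights, count_cat).
do 3!case: ifP; lia.
Qed.

(** Beyond r1 the count becomes (r2+r3+1-m) - (m-r1) = N-2m+1, which is positive exactly up to the
    half of N. *)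
Lemma perm_triple_weights2 r1 r2 r3 (N := (r1 + r2 + r3)%N) :
    (r3 <= r2 <= r1)%N -> (r1 < r2 + r3)%N ->
  perm_eq (triple_weights r1 r2 r3)
    (rep_weights 0 r3.+1 (fun i => i + 1)%N ++
     rep_weights r3.+1 r2.+1 (fun=> r3 + 1)%N ++
     rep_weights r2.+1 r1.+1 (fun i => r3 + r2 + 1 - i)%N ++
     rep_weights r1.+1 (N %/ 2).+1 (fun i => N - 2 * i + 1)%N).
Proof.
move=> /andP[le32 le21] lt_r1; apply: perm_count_mem => m.
rewrite count_triple_weights // !(count_rep_weights, count_cat) /N.
do 4!case: ifP; lia.
Qed.

(** * Restriction to the prime field *)

Lemma frobX_prime_field (p : nat) (Fq : finFieldType) (charFq : p \in [pchar Fq])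
    (j : {rmorphism 'F_p -> Fq}) i x : frobX charFq i (j x) = j x.
Proof.
have pr_p := pcharf_prime charFq.
rewrite /frobX -rmorphXn; congr (j _); elim: i => [|i IHi]; first exact: expr1.
by rewrite expnS exprM -[X in x ^+ X](card_Fp pr_p) expf_card.
Qed.

Lemma models_res_GL (k l : finFieldType) (j : {rmorphism k -> l})
    (K : fieldType) (V : representation K 'GL_2[l]) (I : finType)
    (rho : {'GL_2[l]} -> I -> I -> K) :
  models V rho -> models (res_GL j V) (fun g => rho (map_GL j g)).
Proof. by case=> e bij_e eE; exists e => // g _ i i'; apply: eE; rewrite inE. Qed.

(** The Frobenius twists disappear on the prime field, and the trivial factor ending the iterated
    product is traded for det^0. *)
Lemma rsim_res_Vtensor3 (p : nat) (Fq : finFieldType) (charFq : p \in [pchar Fq])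
    (j : {rmorphism 'F_p -> Fq}) (K : fieldType) (iota : {rmorphism Fq -> K})
    r1 r2 r3 (Sym := fun r => Representation (sym_repr (iota \o j) r)) :
  mx_rsim (res_GL j (Vtensor charFq iota [tuple r1; r2; r3]))
    (prod_grepr (Sym r1) (prod_grepr (Sym r2) (Vdet (iota \o j) r3 0))).
Proof.
have mapE i (g : {'GL_2['F_p]}) : map_mx (iota \o frobX charFq i)
    (map_mx j (GLval g)) = map_mx (iota \o j) (GLval g).
  by apply/matrixP => s t; rewrite !mxE /= frobX_prime_field.
rewrite /Vtensor !big_ord_recl big_ord0.
pose S i r := models_entries (Representation (sym_repr (iota \o frobX charFq i) r)).
pose R r := models_entries (Sym r).
apply: models_eq_rsim
  (models_prod (R r1) (models_prod (R r2) (models_Vdet (iota \o j) r3 0))).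
apply: (models_reindex (f := fun u => (u.1, (u.2.1, (u.2.2, ord0)))) (models_res_GL j
  (models_prod (S 0%N r1) (models_prod (S 1%N r2)
    (models_prod (S 2%N r3) (models_entries grepr1)))))).
  by exists (fun u => (u.1, (u.2.1, u.2.2.1))) => [[a [b c]]|[a [b [c d]]]] //=;
     rewrite [d]ord1.
by move=> g Gg u v /=; rewrite !mapE expr0 [1%:M _ _]mxE.
Qed.

Local Close Scope ring_scope.

Theorem theorem4p1 (p : nat) (hp : prime p)
    (Fq : finFieldType) (charFq : p \in [pchar Fq]%R) (cardFq : #|Fq| = p ^ 3)
    (j : {rmorphism 'F_p -> Fq})
    (K : closedFieldType) (iota : {rmorphism Fq -> K})
    (algK : forall x : K, algebraicOver (iota \o j) x)
    (r1 r2 r3 : nat)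
    (h32 : r3 <= r2) (h21 : r2 <= r1) (h1p : r1 < p - r2 - r3) :
  let N := r1 + r2 + r3 in
  let V := Vdet (iota \o j) in
  (r2 + r3 <= r1 ->
     mx_rsim (res_GL j (Vtensor charFq iota [tuple r1; r2; r3]))
       (dadd_grepr
          (\big[dadd_grepr/grepr0]_(0 <= i < r3.+1)
              muln_grepr (V (N - 2 * i) i) (i + 1))
       (dadd_grepr
          (\big[dadd_grepr/grepr0]_(r3.+1 <= i < r2.+1)
              muln_grepr (V (N - 2 * i) i) (r3 + 1))
          (\big[dadd_grepr/grepr0]_(r2.+1 <= i < (r2 + r3).+1)
              muln_grepr (V (N - 2 * i) i) (r3 + r2 + 1 - i)))))
  /\
  (r1 < r2 + r3 ->
     mx_rsim (res_GL j (Vtensor charFq iota [tuple r1; r2; r3]))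
       (dadd_grepr
          (\big[dadd_grepr/grepr0]_(0 <= i < r3.+1)
              muln_grepr (V (N - 2 * i) i) (i + 1))
       (dadd_grepr
          (\big[dadd_grepr/grepr0]_(r3.+1 <= i < r2.+1)
              muln_grepr (V (N - 2 * i) i) (r3 + 1))
       (dadd_grepr
          (\big[dadd_grepr/grepr0]_(r2.+1 <= i < r1.+1)
              muln_grepr (V (N - 2 * i) i) (r3 + r2 + 1 - i))
          (\big[dadd_grepr/grepr0]_(r1.+1 <= i < (N %/ 2).+1)
              muln_grepr (V (N - 2 * i) i) (N - 2 * i + 1)))))).
Proof.
(* The truncated difference in [h1p] exceeds r1, so it is positive and the hypothesis does say N <
   p. *)
move=> N V; have lt_Np : N < p by rewrite /N; lia.
have factN0 : (N`!%:R != 0 :> K)%R.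
  by apply: natr_fact_pchar_neq0 lt_Np; apply: rmorph_pchar iota _ charFq.
have sim := mx_rsim_trans (rsim_res_Vtensor3 charFq j iota r1 r2 r3)
              (rsim_triple (iota \o j) factN0).
split=> le_r1; apply: mx_rsim_trans sim _.
  apply: mx_rsim_trans (rsim_big_perm _ (perm_triple_weights1 _ le_r1)) _.
    by rewrite h32.
  apply: mx_rsim_trans (rsim_big_cat _ _ _) (rsim_dadd (rsim_big_muln _ _ _ _) _).
  exact: mx_rsim_trans (rsim_big_cat _ _ _)
    (rsim_dadd (rsim_big_muln _ _ _ _) (rsim_big_muln _ _ _ _)).
apply: mx_rsim_trans (rsim_big_perm _ (perm_triple_weights2 _ le_r1)) _.
  by rewrite h32.
apply: mx_rsim_trans (rsim_big_cat _ _ _) (rsim_dadd (rsim_big_muln _ _ _ _) _).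
apply: mx_rsim_trans (rsim_big_cat _ _ _) (rsim_dadd (rsim_big_muln _ _ _ _) _).
exact: mx_rsim_trans (rsim_big_cat _ _ _)
  (rsim_dadd (rsim_big_muln _ _ _ _) (rsim_big_muln _ _ _ _)).
Qed.
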